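(* Fix a positive integer $n$. There are exactly $2^{\binom n2}$ positive gaussoids on $[n]$, namely the gaussoids $\mathcal{G}_\Gamma$, one for each of the undirected simple graphs $\Gamma=([n],E)$. These positive gaussoids are all realizable. The space of covariance matrices $\Sigma$ that realize $\mathcal{G}_\Gamma$ (as a positive gaussoid) is homeomorphic to an open ball of dimension $|E|+n$.
   Context: $[n]=\{1,\dots,n\}$. $\mathcal{P}=\{p_I: I\subseteq[n]\}$ and $\mathcal{A}=\{a_{ij|K}: i,j\in[n]\text{ distinct},\,K\subseteq[n]\setminus\{i,j\}\}$ are sets of unknowns with $a_{ij|K}=a_{ji|K}$. Write $ijL$ for $\{i,j\}\cup L$, etc. The edge trinomials are the following polynomials, for all pairwise distinct $i,j,k\in[n]$ and $L\subseteq[n]\setminus\{i,j,k\}$: $p_{iL}\,a_{jk|L}-p_L\,a_{jk|iL}-a_{ij|L}\,a_{ik|L}$; $p_{ijL}\,a_{ik|L}-p_{iL}\,a_{ik|jL}-a_{ij|L}\,a_{jk|iL}$; $p_{ijkL}\,a_{ij|L}-p_{ijL}\,a_{ij|kL}-a_{ik|jL}\,a_{jk|iL}$. A positive gaussoid on $[n]$ is a map $\phi:\mathcal{A}\to\{0,1\}$ such that for each edge trinomial, after setting all elements of $\mathcal{P}$ to $+1$ and all elements of $\mathcal{A}$ to their images, the set of values of the three signed terms is $\{0\}$, $\{-1,+1\}$ or $\{-1,0,+1\}$. A positive gaussoid is determined by, and identified with, the set $\phi^{-1}(0)\subseteq\mathcal{A}$. For an undirected simple graph $\Gamma=([n],E)$,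 the set $\mathcal{G}_\Gamma\subseteq\mathcal{A}$ consists of all $a_{ij|K}$ such that every path from vertex $i$ to vertex $j$ in $\Gamma$ uses at least one of the vertices in $K$. A covariance matrix is a real positive definite symmetric $n\times n$-matrix $\Sigma$. It realizes the positive gaussoid $\phi$ if, for all $a_{ij|K}\in\mathcal{A}$, the almost-principal minor $a_{ij|K}$ of $\Sigma$ (rows $i$ followed by $K$, columns $j$ followed by $K$, elements of $K$ in increasing order) has sign $\phi(a_{ij|K})$, i.e. it is positive if $\phi(a_{ij|K})=1$ and zero if $\phi(a_{ij|K})=0$. The space of such $\Sigma$ carries the topology induced from the space of real symmetric matrices. *)

(* Defs.v *)
From HB Require Import structures.
From mathcomp Require Import all_boot all_order all_algebra.
From mathcomp Require Import all_classical all_reals all_analysis.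
Set Implicit Arguments.
Unset Strict Implicit.
Unset Printing Implicit Defensive.
Import Order.TTheory GRing.Theory Num.Theory.
Import numFieldNormedType.Exports.

Local Open Scope set_scope.
Local Open Scope ring_scope.

(* The vertex set [n] is 'I_n. The unknown a_{ij|K} = a_{ji|K} is encoded by    *)
(* the pair ({i, j}, K), so that the symmetry in i and j holds by construction. *)
Definition is_apvar n (x : {set 'I_n} * {set 'I_n}) : bool :=
  (#|x.1| == 2)%N && [disjoint x.1 & x.2].

Definition apvar n := {x : {set 'I_n} * {set 'I_n} | is_apvar x}.

(* phi (a_{ij|K}). The default value is only reached when i = j or when K meets *)
(* {i, j}, that is, when a_{ij|K} is not an unknown.                            *)
Definition apval n (phi : {ffun apvar n -> bool})
    (i j : 'I_n) (K : {set 'I_n}) : bool :=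
  oapp phi false (insub ([set i; j]%SET, K)).

(* The three edge trinomials attached to i, j, k, L, each given as the list of  *)
(* its three signed terms, with the unknowns p_I and a_{ij|K} replaced by the   *)
(* ring elements p I and a i j K.                                               *)
Definition edge_trinomials n (A : pzRingType) (p : {set 'I_n} -> A)
    (a : 'I_n -> 'I_n -> {set 'I_n} -> A)
    (i j k : 'I_n) (L : {set 'I_n}) : seq (seq A) :=
  let iL := (i |: L)%SET in
  let jL := (j |: L)%SET in
  let kL := (k |: L)%SET in
  let ijL := (i |: (j |: L))%SET in
  let ijkL := (i |: (j |: (k |: L)))%SET in
  [:: [:: p iL * a j k L; - (p L * a j k iL); - (a i j L * a i k L)];
      [:: p ijL * a i k L; - (p iL * a i k jL); - (a i j L * a j k iL)];
      [:: p ijkL * a i j L; - (p ijL * a i j kL); - (a i k jL * a j k iL)]].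

Definition positive_gaussoid n (phi : {ffun apvar n -> bool}) : Prop :=
  forall (i j k : 'I_n) (L : {set 'I_n}),
    uniq [:: i; j; k] -> i \notin L -> j \notin L -> k \notin L ->
    forall t : seq int,
      t \in edge_trinomials (fun=> 1)
              (fun x y K => (apval phi x y K : nat)%:Z) i j k L ->
      [\/ t =i [:: 0], t =i [:: -1; 1] | t =i [:: -1; 0; 1]].

Definition positive_gaussoids n : {set {ffun apvar n -> bool}} :=
  [set phi : {ffun apvar n -> bool} | `[< positive_gaussoid phi >] ]%SET.

Definition zero_set n (phi : {ffun apvar n -> bool}) : {set apvar n} :=
  [set x : apvar n | ~~ phi x]%SET.

Definition map_of_zero_set n (G : {set apvar n}) : {ffun apvar n -> bool} :=
  [ffun x => x \notin G].

Lemma zero_setK n : cancel (@zero_set n) (@map_of_zero_set n).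
Proof. by move=> phi; apply/ffunP=> x; rewrite ffunE inE negbK. Qed.

Lemma map_of_zero_setK n : cancel (@map_of_zero_set n) (@zero_set n).
Proof. by move=> G; apply/setP=> x; rewrite inE ffunE negbK. Qed.

Definition simple_graph n :=
  {E : {set {set 'I_n}} | [forall e in E, #|e : {set 'I_n}| == 2%N]}.

Definition edges n (Gamma : simple_graph n) : {set {set 'I_n}} := val Gamma.

Definition adjacent n (Gamma : simple_graph n) : rel 'I_n :=
  fun i j => [set i; j]%SET \in edges Gamma.

(* i :: s ranges over the paths from i to j, listed by their vertices.          *)
Definition separates n (Gamma : simple_graph n)
    (i j : 'I_n) (K : {set 'I_n}) : Prop :=
  forall s : seq 'I_n, path (adjacent Gamma) i s -> uniq (i :: s) ->
    last i s = j -> exists2 k, k \in K & k \in i :: s.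

Definition graph_gaussoid n (Gamma : simple_graph n) : {set apvar n} :=
  [set x : apvar n | `[< forall i j : 'I_n, (val x).1 = [set i; j]%SET ->
                           separates Gamma i j (val x).2 >] ]%SET.

Definition covariance_matrix (R : realType) n (Sigma : 'M[R]_n) : Prop :=
  Sigma^T = Sigma /\
  forall v : 'cV[R]_n, v != 0 -> 0 < (v^T *m Sigma *m v) 0 0.

(* enum K lists K in increasing order.                                          *)
Definition almost_principal_minor (R : realType) n (Sigma : 'M[R]_n)
    (i j : 'I_n) (K : {set 'I_n}) : R :=
  \det (\matrix_(r < #|K|.+1, c < #|K|.+1)
          Sigma (nth i (i :: enum K) r) (nth j (j :: enum K) c)).

Definition realizes (R : realType) n (Sigma : 'M[R]_n)
    (phi : {ffun apvar n -> bool}) : Prop :=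
  forall (i j : 'I_n) (K : {set 'I_n}), i != j -> i \notin K -> j \notin K ->
    Num.sg (almost_principal_minor Sigma i j K) = (apval phi i j K)%:R.

Local Open Scope classical_set_scope.

Definition realization_space (R : realType) n
    (phi : {ffun apvar n -> bool}) : set 'M[R]_n :=
  [set Sigma | covariance_matrix Sigma /\ realizes Sigma phi].
Arguments realization_space R {n} phi _.

(* The Euclidean ball: the norm of the library on 'rV[R]_d is the maximum norm. *)
Definition open_unit_ball (R : realType) (d : nat) : set 'rV[R]_d :=
  [set x | \sum_(k < d) x 0 k ^+ 2 < 1].
Arguments open_unit_ball R d _ : clear implicits.

Definition homeomorphic (T U : topologicalType) : Prop :=
  exists (f : T -> U) (g : U -> T),
    [/\ continuous f, continuous g, cancel f g & cancel g f].

(* Main.v *)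
Require Import Defs.
From HB Require Import structures.
From mathcomp Require Import all_boot all_order all_algebra.
From mathcomp Require Import all_classical all_reals all_analysis.
From mathcomp Require Import ring.
Import numFieldNormedType.Exports.

(** For maps to {0, 1}, the sign condition on each edge trinomial is a Boolean
    equation ([trinomial_signs]). The equation of the third kind,
      a_{ij|L} = a_{ij|kL} or (a_{ik|jL} and a_{jk|iL}),
    computes the values at L from values at larger sets, so a positive gaussoid
    is determined by its values a_{ij|K} with K the complement of {i, j}, that
    is, by a graph. The connectivity of a graph outside a set of vertices
    satisfies the same recursion: a simple path from i to j either avoids k or
    can be cut at k ([linked_split]). Hence the positive gaussoids are the graph
    gaussoids ([positive_gaussoidE], [graph_gaussoid_positive]), and different
    graphs give different gaussoids.

    Let Q be the inverse of a covariance matrix Sigma. Up to a positive factor,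
    a_{ij|K} is the (i, j) entry of the inverse of the submatrix of Q on the
    complement of K ([ex_conditional_column]). For K the complement of {i, j}
    this entry has the sign of - Q i j, so if Sigma realizes the gaussoid of
    Gamma then Q has negative entries at the edges and zeros at the non-edges.
    Conversely, the inverse of a positive definite matrix with nonpositive
    off-diagonal entries is nonnegative, and its positive entries are those
    between connected vertices ([sg_Mmatrix_inv]); applied to the submatrices of
    Q, this gives all the required signs ([realizes_graphP]).

    The matrices Q found in this way form an open convex cone, for which there
    is an explicit chart. Besides the edge entries, take as coordinates the row
    sums u = Sigma (1, ..., 1), which are positive. The equation
    Q u = (1, ..., 1) recovers the diagonal of Q, and conversely any positive u
    and any negative edge entries give a positive definite Q, by writing its
    quadratic form as a sum of squares ([covariance_Mmatrix]). So the
    realization space is homeomorphic to an open orthant of dimension |E| + n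
    ([homeomorphic_orthant_realization]), which is homeomorphic to a ball
    ([homeomorphic_ball_orthant]). In particular it is not empty. *)

(** * Positive gaussoids and connectivity of graphs *)

Section GraphGaussoids.
Set Implicit Arguments.
Unset Strict Implicit.
Import Order.TTheory GRing.Theory Num.Theory.
Local Notation adjacent := Defs.adjacent.

Definition avoiding n (Gamma : simple_graph n) (K : {set 'I_n}) : rel 'I_n :=
  [rel x y | [&& adjacent Gamma x y, x \notin K & y \notin K]].

(** The complement, on the vertices outside K, of separation by K. A reflexive
    transitive closure is easier to reason with than simple paths. *)
Definition linked n (Gamma : simple_graph n) (K : {set 'I_n}) : rel 'I_n :=
  connect (avoiding Gamma K).

Lemma adjacent_sym n (Gamma : simple_graph n) : symmetric (adjacent Gamma).
Proof. by move=> i j; rewrite /adjacent finset.setUC. Qed.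

Lemma adjacent_neq n (Gamma : simple_graph n) (i j : 'I_n) :
  adjacent Gamma i j -> i != j.
Proof.
move=> adj; have := forall_inP (valP Gamma) _ adj.
by rewrite cards2; case: (i == j).
Qed.

Lemma linked_sym n (Gamma : simple_graph n) K i j :
  linked Gamma K i j = linked Gamma K j i.
Proof.
apply: sym_connect_sym => x y; rewrite /avoiding /=.
by rewrite adjacent_sym; congr andb; rewrite andbC.
Qed.

Lemma linked_trans n (Gamma : simple_graph n) K : transitive (linked Gamma K).
Proof. exact: connect_trans. Qed.

Lemma linkedW n (Gamma : simple_graph n) (K L : {set 'I_n}) i j :
  K \subset L -> linked Gamma L i j -> linked Gamma K i j.
Proof.
move=> /fintype.subsetP KL; apply: connect_sub => x y.
rewrite {1}/avoiding /= => /and3P[xy xL yL].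
by apply: connect1; rewrite /avoiding /= xy !(contra (KL _)).
Qed.

Lemma path_avoiding n (Gamma : simple_graph n) (K : {set 'I_n}) i s :
  i \notin K ->
  path (avoiding Gamma K) i s =
    path (adjacent Gamma) i s && all (fun x => x \notin K) s.
Proof.
elim: s i => //= x s IHs i iK; rewrite {1}/avoiding /= iK /=.
have [xK|xK] /= := boolP (x \in K); first by rewrite !andbF.
by rewrite andbT IHs // andbA.
Qed.

Lemma linkedP n (Gamma : simple_graph n) (K : {set 'I_n}) i j : i \notin K ->
  reflect (exists s, [/\ path (adjacent Gamma) i s, uniq (i :: s), last i s = j
                       & all (fun x => x \notin K) s])
          (linked Gamma K i j).
Proof.
move=> iK; apply: (iffP connectP) => [[s s_path ->]|[s [s_path _ <- sK]]].
  case/shortenP: s_path => s' s'_path s'_uniq _.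
  by move: s'_path; rewrite path_avoiding // => /andP[? ?]; exists s'.
by exists s => //; rewrite path_avoiding // s_path.
Qed.

(** Loops can be cut out of a walk, so [linked], which speaks of walks, agrees
    with separation, which speaks of simple paths. *)
Lemma linkedE n (Gamma : simple_graph n) (K : {set 'I_n}) i j : i \notin K ->
  linked Gamma K i j = ~~ `[< separates Gamma i j K >].
Proof.
move=> iK; apply/(linkedP Gamma j iK)/asboolPn => [[s [s_path s_uniq sj sK]] sep|].
  have [k kK] := sep s s_path s_uniq sj.
  rewrite inE => /orP[/eqP ki|]; first by rewrite -ki kK in iK.
  by move/(allP sK); rewrite kK.
move=> nsep; apply: contrapT => no_s; apply: nsep => s s_path s_uniq sj.
have /allPn[k ks /negPn kK] : ~~ all (fun x => x \notin K) s.
  by apply/negP => sK; apply: no_s; exists s.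
by exists k => //; rewrite inE ks orbT.
Qed.

(** The third edge trinomial for the connectivity of a graph. A simple path
    from i to j that meets k is cut at k: its first half misses j and its second
    half misses i because no vertex is repeated. *)
Lemma linked_split n (Gamma : simple_graph n) (L : {set 'I_n}) i j k :
  i != j -> i != k -> j != k -> i \notin L -> j \notin L -> k \notin L ->
  linked Gamma L i j =
    linked Gamma (k |: L) i j
    || linked Gamma (j |: L) i k && linked Gamma (i |: L) j k.
Proof.
move=> ij ik jk iL jL kL; apply/idP/orP => [|[|/andP[ik_l jk_l]]]; last first.
- apply: linked_trans (linkedW (finset.subsetUr _ _) ik_l) _.
  by rewrite linked_sym (linkedW (finset.subsetUr _ _) jk_l).
- exact/linkedW/finset.subsetUr.
move=> /(linkedP _ _ iL)[s [s_path s_uniq sj sL]].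
have [ks|ks] := boolP (k \in s); last first.
  left; apply/linkedP; first by rewrite !inE negb_or ik.
  exists s; split=> //; apply/allP => x xs.
  rewrite !inE negb_or (allP sL _ xs) andbT.
  by apply: contraNneq ks => <-.
right; case/splitPr: ks s_path s_uniq sj sL => p1 p2.
rewrite -cat_rcons cat_path last_rcons => /andP[p1_path p2_path] s_uniq.
rewrite last_cat last_rcons all_cat => p2j /andP[p1L p2L].
(* p2 is nonempty, so its last vertex j is one of its members. *)
have p2_nil : p2 != [::] by apply: contraNneq jk => p2_nil; rewrite -p2j p2_nil.
have jp2 : j \in p2.
  by case: p2 p2_nil p2j {p2_path s_uniq p2L} => //= x p _ <-; exact: mem_last.
move: s_uniq; rewrite -cat_cons cat_uniq => /and3P[p1_uniq disj p2_uniq].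
have disjP x : x \in p2 -> x \notin i :: rcons p1 k.
  by move=> xp2; apply: contra disj => xp1; apply/hasP; exists x.
apply/andP; split.
  apply/linkedP; first by rewrite !inE negb_or ij.
  exists (rcons p1 k); split=> //; first by rewrite last_rcons.
  apply/allP => x xp1; rewrite !inE negb_or (allP p1L _ xp1) andbT.
  by apply: contraNneq (disjP _ jp2) => <-; rewrite inE xp1 orbT.
rewrite linked_sym; apply/linkedP; first by rewrite !inE negb_or kL eq_sym ik.
exists p2; split=> //.
  rewrite /= p2_uniq andbT; apply/negP => /disjP.
  by rewrite inE mem_rcons mem_head orbT.
apply/allP => x xp2; rewrite !inE negb_or (allP p2L _ xp2) andbT.
by apply: contraTneq xp2 => ->; apply/negP => /disjP; rewrite mem_head.
Qed.

Lemma apvalE n (phi : {ffun apvar n -> bool}) (i j : 'I_n) (K : {set 'I_n})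
    (x : apvar n) :
  val x = ([set i; j]%SET, K) -> apval phi i j K = phi x.
Proof. by rewrite /apval => <-; rewrite valK. Qed.

Lemma ex_apvar n (i j : 'I_n) (K : {set 'I_n}) :
  i != j -> i \notin K -> j \notin K ->
  exists x : apvar n, val x = ([set i; j]%SET, K).
Proof.
move=> ij iK jK; suff x_ok : is_apvar ([set i; j]%SET, K).
  by exists (Sub _ x_ok); rewrite SubK.
rewrite /is_apvar /= cards2 ij disjoint_subset; apply/fintype.subsetP => x.
by rewrite !inE => /orP[] /eqP ->.
Qed.

Lemma apvarP n (x : apvar n) : exists i j (K : {set 'I_n}),
  [/\ i != j, i \notin K, j \notin K & val x = ([set i; j]%SET, K)].
Proof.
case: x => -[e K] /= /andP[/= /cards2P[i [j [ij ->]]]].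
rewrite disjoint_subset => /fintype.subsetP sub; exists i, j, K; split=> //.
  by have := sub i; rewrite !inE eqxx; apply.
by have := sub j; rewrite !inE eqxx orbT; apply.
Qed.

(** Separation is symmetric, so the two orders of the endpoints in the
    definition of [graph_gaussoid] impose the same condition. *)
Lemma apval_graph n (Gamma : simple_graph n) (i j : 'I_n) (K : {set 'I_n}) :
  i != j -> i \notin K -> j \notin K ->
  apval (map_of_zero_set (graph_gaussoid Gamma)) i j K = linked Gamma K i j.
Proof.
move=> ij iK jK.
have [x xE] := ex_apvar ij iK jK.
rewrite (apvalE _ xE) ffunE inE xE /= linkedE //; congr (~~ _).
apply: asbool_equiv_eq; split=> [sep|sep i' j' ij']; first exact: sep.
have [i'K j'K] : i' \notin K /\ j' \notin K.
  have i'ij : i' \in [set i; j]%SET by rewrite ij' set21.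
  have j'ij : j' \in [set i; j]%SET by rewrite ij' set22.
  by split; [case/set2P: i'ij => -> | case/set2P: j'ij => ->].
have nlink : ~~ linked Gamma K i j by rewrite linkedE // negbK; apply/asboolP.
suff : ~~ linked Gamma K i' j' by rewrite linkedE // negbK => /asboolP.
have iij' : i \in [set i'; j']%SET by rewrite -ij' set21.
have jij' : j \in [set i'; j']%SET by rewrite -ij' set22.
case/set2P: iij' => iE; case/set2P: jij' => jE; first by rewrite iE jE eqxx in ij.
- by rewrite -iE -jE.
- by rewrite linked_sym -iE -jE.
by rewrite iE jE eqxx in ij.
Qed.

Local Open Scope ring_scope.

(** The signs of the terms of a - b - c * d, for 0/1 values, are compatible with
    a zero sum when the positive term is nonzero if and only if one of the two
    negative terms is. *)
Lemma trinomial_signs (a b c d : bool) :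
  [\/ [:: 1 * (a : nat)%:Z; - (1 * (b : nat)%:Z); - ((c : nat)%:Z * (d : nat)%:Z)]
        =i [:: 0],
      [:: 1 * (a : nat)%:Z; - (1 * (b : nat)%:Z); - ((c : nat)%:Z * (d : nat)%:Z)]
        =i [:: -1; 1]
    | [:: 1 * (a : nat)%:Z; - (1 * (b : nat)%:Z); - ((c : nat)%:Z * (d : nat)%:Z)]
        =i [:: -1; 0; 1]] <-> a = b || c && d.
Proof.
split=> [|->]; last first.
  case: b; case: c; case: d; rewrite /= ?mul1r ?mulr1 ?mulr0 ?mul0r ?oppr0.
  - by apply: Or32 => x; rewrite !inE; case: (x == 1); case: (x == -1).
  - by apply: Or33 => x; rewrite !inE; case: (x == 1); case: (x == -1); case: (x == 0).
  - by apply: Or33 => x; rewrite !inE; case: (x == 1); case: (x == -1); case: (x == 0).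
  - by apply: Or33 => x; rewrite !inE; case: (x == 1); case: (x == -1); case: (x == 0).
  - by apply: Or33 => x; rewrite !inE; case: (x == 1); case: (x == -1); case: (x == 0).
  - by apply: Or31 => x; rewrite !inE; case: (x == 0).
  - by apply: Or31 => x; rewrite !inE; case: (x == 0).
  - by apply: Or31 => x; rewrite !inE; case: (x == 0).
by case: a; case: b; case: c; case: d => //;
  case=> t; move: (t 0) (t 1) (t (-1)).
Qed.

Local Close Scope ring_scope.

Lemma positive_gaussoidP n (phi : {ffun apvar n -> bool}) :
  positive_gaussoid phi <->
  forall (i j k : 'I_n) (L : {set 'I_n}),
    i != j -> i != k -> j != k -> i \notin L -> j \notin L -> k \notin L ->
    [/\ apval phi j k L
          = apval phi j k (i |: L) || apval phi i j L && apval phi i k L,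
        apval phi i k L
          = apval phi i k (j |: L) || apval phi i j L && apval phi j k (i |: L)
      & apval phi i j L
          = apval phi i j (k |: L)
            || apval phi i k (j |: L) && apval phi j k (i |: L)].
Proof.
have uniqE (i j k : 'I_n) : uniq [:: i; j; k] = [&& i != j, i != k & j != k].
  by rewrite /= !inE negb_or !andbT andbA.
split=> pos i j k L.
  move=> ij ik jk iL jL kL.
  have U : uniq [:: i; j; k] by rewrite uniqE ij ik.
  by split; apply/trinomial_signs; apply: (pos i j k L U iL jL kL);
    rewrite !inE eqxx ?orbT.
rewrite uniqE => /and3P[ij ik jk] iL jL kL.
have [E1 E2 E3] := pos i j k L ij ik jk iL jL kL.
by move=> t; rewrite !inE => /or3P[] /eqP->; apply/trinomial_signs.
Qed.

(** The first two Boolean equations follow from [linked_split] with the roles of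
    the vertices exchanged, since enlarging the separating set only cuts
    connections and connectivity is transitive. *)
Lemma graph_gaussoid_positive n (Gamma : simple_graph n) :
  positive_gaussoid (map_of_zero_set (graph_gaussoid Gamma)).
Proof.
apply/positive_gaussoidP => i j k L ij ik jk iL jL kL.
have ji : j != i by rewrite eq_sym.
have ki : k != i by rewrite eq_sym.
have kj : k != j by rewrite eq_sym.
rewrite !apval_graph ?finset.in_setU1 ?negb_or ?ij ?ik ?jk ?ji ?ki ?kj //.
split; last exact: linked_split.
  rewrite (linked_split Gamma jk ji ki jL kL iL).
  apply/idP/idP => /orP[->//|/andP[l1 l2]]; apply/orP.
    right; rewrite linked_sym (linkedW (finset.subsetUr _ _) l1).
    by rewrite linked_sym (linkedW (finset.subsetUr _ _) l2).
  by apply/orP; rewrite -linked_split //; apply: linked_trans l2; rewrite linked_sym.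
rewrite (linked_split Gamma ik ij kj iL kL jL).
apply/idP/idP => /orP[->//|/andP[l1 l2]]; apply/orP.
  by right; rewrite (linkedW (finset.subsetUr _ _) l1) linked_sym.
apply/orP; rewrite -linked_split //.
exact: linked_trans l1 (linkedW (finset.subsetUr _ _) l2).
Qed.

Lemma linked_full n (Gamma : simple_graph n) i j : i != j ->
  linked Gamma (~: [set i; j]) i j = adjacent Gamma i j.
Proof.
move=> ij; apply/idP/idP => [/connectP[[|x s] /=]|adj]; last first.
- by apply: connect1; rewrite /avoiding /= adj !inE !eqxx orbT.
- move=> /andP[/and3P[adj _]]; rewrite !inE negbK => /orP[] /eqP xE _ _.
    by have := adjacent_neq adj; rewrite xE eqxx.
  by rewrite -xE.
- by move=> _ ji; rewrite ji eqxx in ij.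
Qed.

(** A graph has to be read off from its gaussoid at the full conditioning set,
    where the only possible connecting path is a single edge. *)
Definition gaussoid_edges n (phi : {ffun apvar n -> bool}) : {set {set 'I_n}} :=
  [set e : {set 'I_n} | (#|e| == 2) && oapp phi false (insub (e, ~: e))]%SET.

Lemma gaussoid_edges_subproof n (phi : {ffun apvar n -> bool}) :
  [forall e in gaussoid_edges phi, #|e : {set 'I_n}| == 2%N].
Proof. by apply/forall_inP => e; rewrite inE => /andP[]. Qed.

Definition gaussoid_graph n (phi : {ffun apvar n -> bool}) : simple_graph n :=
  Sub (gaussoid_edges phi) (gaussoid_edges_subproof phi).

Lemma adjacent_gaussoid n (phi : {ffun apvar n -> bool}) i j : i != j ->
  adjacent (gaussoid_graph phi) i j = apval phi i j (~: [set i; j]).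
Proof. by move=> ij; rewrite /adjacent inE cards2 ij. Qed.

(** The third Boolean equation expresses the values at K through values at
    larger sets. Since connectivity obeys the same recursion
    ([linked_split]), a positive gaussoid that agrees with a graph at the full
    conditioning sets agrees with it everywhere. *)
Lemma positive_gaussoidE n (phi : {ffun apvar n -> bool}) :
  positive_gaussoid phi ->
  phi = map_of_zero_set (graph_gaussoid (gaussoid_graph phi)).
Proof.
move=> /positive_gaussoidP pos; set Gamma := gaussoid_graph phi.
have main m i j (K : {set 'I_n}) : #|~: K| <= m -> i != j -> i \notin K ->
    j \notin K -> apval phi i j K = linked Gamma K i j.
  elim: m i j K => [|m IHm] i j K Km ij iK jK.
    move: Km; rewrite leqn0 cards_eq0 => /eqP/setP/(_ i).
    by rewrite !inE iK.
  have [sub|/fintype.subsetPn[k]] := boolP (~: K \subset [set i; j]).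
    have -> : K = ~: [set i; j].
      apply/setP => x; apply/idP/idP => [xK|].
        by rewrite !inE; apply: contraL xK => /orP[] /eqP->.
      by rewrite !inE => xij; apply: contraR xij => xK; have := fintype.subsetP sub x;
        rewrite !inE; apply.
    by rewrite linked_full // adjacent_gaussoid.
  rewrite !inE negb_or => kK /andP[ki kj].
  have [ik jk] : i != k /\ j != k by rewrite (eq_sym i) (eq_sym j).
  have less x : x \notin K -> #|~: (x |: K)| <= m.
    move=> xK; have := cardsC (x |: K); rewrite cardsU1 xK -(cardsC K) add1n.
    by rewrite addSn -addnS => /eqP; rewrite eqn_add2l => /eqP E; rewrite -ltnS E.
  have [_ _ ->] := pos i j k K ij ik jk iK jK kK.
  rewrite !IHm ?less ?finset.in_setU1 ?negb_or ?ij ?ik ?jk ?ki ?kj //.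
    by rewrite -linked_split.
  by rewrite eq_sym ij.
apply/ffunP => x; have [i [j [K [ij iK jK xE]]]] := apvarP x.
rewrite -(apvalE phi xE) -(apvalE _ xE) apval_graph // (main #|'I_n|) //.
exact: max_card.
Qed.

Lemma graph_gaussoid_inj n : injective (@graph_gaussoid n).
Proof.
move=> G1 G2 eqG; apply: val_inj; apply/setP => e.
have [/cards2P[i [j [ij ->]]]|e2] := boolP (#|e| == 2); last first.
  have edge2 (G : simple_graph n) : (e \in val G) = false.
    by apply: contraNF e2; case: G => E /= /forall_inP; apply.
  by rewrite !edge2.
rewrite -[LHS]/(adjacent G1 i j) -[RHS]/(adjacent G2 i j) -!linked_full //.
by rewrite -!apval_graph ?inE ?negbK ?eqxx ?orbT // eqG.
Qed.

Lemma positive_gaussoid_zero_sets n :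
  [set zero_set phi | phi in positive_gaussoids n]%SET
    = [set graph_gaussoid Gamma | Gamma : simple_graph n]%SET.
Proof.
apply/setP => G; apply/imsetP/imsetP => [[phi]|[Gamma _ ->]].
  rewrite inE => /asboolP/positive_gaussoidE E ->.
  by exists (gaussoid_graph phi); rewrite // {1}E map_of_zero_setK.
exists (map_of_zero_set (graph_gaussoid Gamma)); last by rewrite map_of_zero_setK.
by rewrite inE; apply/asboolP/graph_gaussoid_positive.
Qed.

Lemma card_simple_graph n : #|{: simple_graph n}| = 2 ^ 'C(n, 2).
Proof.
rewrite card_sig -[n in RHS]card_ord -(card_draws 'I_n 2) -card_powerset.
apply: eq_card => E; rewrite !inE; apply/forall_inP/fintype.subsetP => H e /H.
  by rewrite inE.
by rewrite inE.
Qed.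

Lemma card_positive_gaussoids n : #|positive_gaussoids n| = 2 ^ 'C(n, 2).
Proof.
rewrite -card_simple_graph -(card_imset _ (can_inj (@zero_setK n))).
by rewrite positive_gaussoid_zero_sets (card_imset _ (@graph_gaussoid_inj n)).
Qed.

End GraphGaussoids.

(** * Signs of almost-principal minors of a covariance matrix *)

Section CovarianceMatrices.
Set Implicit Arguments.
Unset Strict Implicit.
Import Order.TTheory GRing.Theory Num.Theory.
Local Notation adjacent := Defs.adjacent.
Local Open Scope ring_scope.

Lemma covariance_unit (R : realType) n (A : 'M[R]_n) :
  covariance_matrix A -> A \in unitmx.
Proof.
move=> [_ A_pos]; rewrite unitmxE unitfE; apply/det0P => -[v v0 vA].
have : v^T != 0.
  by apply: contraNneq v0 => /(congr1 trmx); rewrite trmxK trmx0 => ->.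
by move/A_pos; rewrite trmxK vA mul0mx mxE ltxx.
Qed.

Lemma covariance_inv (R : realType) n (A : 'M[R]_n) :
  covariance_matrix A -> covariance_matrix (invmx A).
Proof.
move=> Acov; have Au := covariance_unit Acov; case: Acov => A_sym A_pos.
split=> [|v v0]; first by rewrite trmx_inv A_sym.
have w0 : invmx A *m v != 0.
  by apply: contraNneq v0 => w0; rewrite -(mulKVmx Au v) w0 mulmx0.
by have := A_pos _ w0; rewrite trmx_mul trmx_inv A_sym -!mulmxA mulKVmx.
Qed.

Lemma covariance_inj (R : realType) n (A : 'M[R]_n) (v w : 'cV[R]_n) :
  covariance_matrix A -> A *m v = A *m w -> v = w.
Proof. by move=> /covariance_unit Au /(congr1 (mulmx (invmx A))); rewrite !mulKmx. Qed.

Lemma covariance_mxsub (R : realType) n m (A : 'M[R]_n) (f : 'I_m -> 'I_n) :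
  injective f -> covariance_matrix A -> covariance_matrix (mxsub f f A).
Proof.
move=> f_inj [A_sym A_pos]; split=> [|v v0].
  by rewrite -[in RHS]A_sym trmx_mxsub.
pose P : 'M[R]_(m, n) := rowsub f 1%:M.
have PT : P^T = colsub f 1%:M by rewrite /P trmx_mxsub trmx1.
have PPT : P *m P^T = 1%:M.
  rewrite PT mulmx_colsub mulmx1; apply/matrixP => r c.
  by rewrite !mxE (inj_eq f_inj).
have -> : mxsub f f A = P *m A *m P^T.
  rewrite PT mulmx_colsub mulmx1 mul_rowsub_mx mul1mx.
  by apply/matrixP => r c; rewrite !mxE.
have w0 : P^T *m v != 0.
  by apply: contraNneq v0 => w0; rewrite -[v]mul1mx -PPT -mulmxA w0 mulmx0.
by have := A_pos _ w0; rewrite trmx_mul trmxK !mulmxA.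
Qed.

Lemma mulmx_entry (R : realType) n (u v : 'cV[R]_n) :
  (u^T *m v) 0 0 = \sum_i u i 0 * v i 0.
Proof. by rewrite mxE; apply: eq_bigr => i _; rewrite mxE. Qed.

(** Positivity of a diagonal entry of the inverse: x j 0 is the value of the
    quadratic form of A at x. *)
Lemma covariance_column_gt0 (R : realType) n (A : 'M[R]_n) (x : 'cV[R]_n) j :
  covariance_matrix A -> A *m x = delta_mx j 0 -> 0 < x j 0.
Proof.
move=> [_ A_pos] Ax; have x0 : x != 0.
  apply/eqP => x0; move/colP/(_ j)/eqP: Ax.
  by rewrite x0 mulmx0 !mxE !eqxx eq_sym oner_eq0.
have := A_pos x x0; rewrite -mulmxA Ax mulmx_entry (bigD1 j) //=.
rewrite big1 => [|k kj]; first by rewrite mxE !eqxx mulr1 addr0.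
by rewrite mxE (negPf kj) mulr0.
Qed.

(** Cramer's rule for the first unknown, read backwards: it compares the sign of
    a determinant with the sign of its leading principal cofactor. Working with
    the (0, 0) cofactor only avoids all permutation signs. *)
Lemma cramer_first (R : realType) m (B : 'M[R]_m.+1) (v : 'cV[R]_m.+1) (x : R) :
  B *m v = x *: delta_mx 0 0 ->
  \det B * v 0 0 = x * \det (row' 0 (col' 0 B)).
Proof.
move=> /(congr1 (mulmx (\adj B))); rewrite mulmxA mul_adj_mx mul_scalar_mx.
move=> /matrixP/(_ 0 0); rewrite -scalemxAr !mxE => ->; congr (_ * _).
rewrite (bigD1 0) //= big1 => [|k k0]; last by rewrite !mxE (negPf k0) mulr0.
by rewrite !mxE eqxx mulr1 addr0 /cofactor addn0 expr0 mul1r.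
Qed.

(** Induction on the size: the first column of the inverse has a positive first
    entry, so by [cramer_first] the determinant has the sign of the determinant
    of a smaller covariance matrix. *)
Lemma covariance_det_gt0 (R : realType) m (B : 'M[R]_m) :
  covariance_matrix B -> 0 < \det B.
Proof.
elim: m B => [|m IHm] B Bcov; first by rewrite det_mx00.
pose e : 'cV[R]_m.+1 := delta_mx 0 0.
pose v := invmx B *m e.
have Bv : B *m v = 1 *: e by rewrite scale1r mulKVmx // covariance_unit.
have v0 : 0 < v 0 0 by apply: covariance_column_gt0 Bcov _; rewrite Bv scale1r.
have := cramer_first Bv; rewrite mul1r => detE.
rewrite -(pmulr_lgt0 _ v0) detE IHm //.
suff -> : row' 0 (col' 0 B) = mxsub (lift 0) (lift 0) B.
  by apply: covariance_mxsub => //; exact: lift_inj.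
by apply/matrixP => r c; rewrite !mxE.
Qed.

(** A vector y supported on j and K, with y j = 1, whose image vanishes on K
    solves the linear system whose matrix is that of a_{ij|K}, with right-hand
    side a multiple of the first unit vector. The cofactor in [cramer_first] is
    the principal minor on K, which is positive. *)
Lemma sg_almost_principal_minor (R : realType) n (Sigma : 'M[R]_n) i j
    (K : {set 'I_n}) (y : 'cV[R]_n) :
  covariance_matrix Sigma -> j \notin K ->
  (forall m, m \notin K -> y m 0 = (m == j)%:R) ->
  (forall k, k \in K -> (Sigma *m y) k 0 = 0) ->
  Num.sg (almost_principal_minor Sigma i j K) = Num.sg ((Sigma *m y) i 0).
Proof.
move=> Scov jK yM xK; rewrite /almost_principal_minor.
set B := (X in \det X); pose v : 'cV[R]_(#|K|.+1) :=
  \col_c y (nth j (j :: enum K) c) 0.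
have Bv : B *m v = (Sigma *m y) i 0 *: delta_mx 0 0.
  apply/colP => r; rewrite [RHS]mxE [delta_mx _ _ _ _]mxE [LHS]mxE eqxx andbT.
  set a := nth i (i :: enum K) r.
  transitivity ((Sigma *m y) a 0).
    symmetry; rewrite mxE; symmetry.
    transitivity (\sum_(l <- j :: enum K) Sigma a l * y l 0).
      rewrite (big_nth j) /= -cardE big_mkord.
      by apply: eq_bigr => c _; rewrite !mxE.
    rewrite big_cons big_enum /= [RHS](bigD1 j) //=; congr (_ + _).
    rewrite [RHS](bigID (mem K)) /= [X in _ = _ + X]big1 => [|l /andP[lj lK]].
      rewrite addr0; apply: eq_bigl => l.
      by have [->|//] := eqVneq l j; rewrite (negPf jK).
    by rewrite yM // (negPf lj) mulr0.
  case: (eqVneq r 0) => [r0|r0]; first by rewrite /a r0 mulr1.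
  rewrite /= mulr0 xK // /a.
  case: r r0 @a => -[//|r] r_lt r0 /=.
  by rewrite -mem_enum mem_nth // -cardE.
have detB := cramer_first Bv.
have v0 : v 0 0 = 1 by rewrite mxE /= yM // eqxx.
rewrite v0 mulr1 in detB; rewrite detB sgrM.
suff -> : row' 0 (col' 0 B) = mxsub (@enum_val _ (mem K)) (@enum_val _ (mem K)) Sigma.
  rewrite (gtr0_sg (covariance_det_gt0 _)) ?mulr1 //.
  by apply: covariance_mxsub => //; exact: enum_val_inj.
apply/matrixP => r c; rewrite !mxE.
by rewrite (enum_val_nth i) (enum_val_nth j) /=.
Qed.

(** A positive definite matrix with nonpositive off-diagonal entries is
    inverse-positive. For z the negative part of x, the off-diagonal signs
    make the value of the quadratic form at z at most minus the product of z
    and A *m x, hence nonpositive, so z = 0. *)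
Lemma Mmatrix_ge0 (R : realType) n (A : 'M[R]_n) (x : 'cV[R]_n) :
  covariance_matrix A -> (forall i j, i != j -> A i j <= 0) ->
  (forall i, 0 <= (A *m x) i 0) -> forall i, 0 <= x i 0.
Proof.
move=> [_ A_pos] A_off Ax i.
pose z : 'cV[R]_n := \col_k Num.max (- x k 0) 0.
pose p : 'cV[R]_n := \col_k Num.max (x k 0) 0.
have z_ge0 k : 0 <= z k 0 by rewrite mxE le_max lexx orbT.
have p_ge0 k : 0 <= p k 0 by rewrite mxE le_max lexx orbT.
have zp k : z k 0 * p k 0 = 0.
  rewrite !mxE; case: (leP (x k 0) 0) => x0; first by rewrite mulr0.
  by rewrite max_r ?mul0r // oppr_le0 ltW.
have xE : x = p - z.
  apply/colP => k; rewrite !mxE; case: (leP (x k 0) 0) => x0.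
    by rewrite max_l ?oppr_ge0 // sub0r opprK.
  by rewrite max_r ?subr0 // oppr_le0 ltW.
have zAz : (z^T *m A *m z) 0 0 <= 0.
  have : 0 <= (z^T *m (A *m x)) 0 0.
    by rewrite mulmx_entry; apply: sumr_ge0 => k _; exact: mulr_ge0.
  rewrite xE mulmxBr mulmxBr mxE [X in _ + X]mxE subr_ge0 !mulmxA => /le_trans; apply.
  rewrite -mulmxA mulmx_entry; apply: sumr_le0 => k _; rewrite [(A *m p) k 0]mxE mulr_sumr.
  apply: sumr_le0 => l _; have [->|kl] := eqVneq l k.
    by rewrite mulrCA zp mulr0.
  apply: mulr_ge0_le0 => //; apply: mulr_le0_ge0 => //.
  by apply: A_off; rewrite eq_sym.
have [z0|/A_pos] := eqVneq z 0; last by rewrite ltNge zAz.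
by rewrite xE z0 subr0.
Qed.

(** The entries of the inverse are positive exactly between connected vertices.
    A neighbour of a positive entry is positive: at a vanishing entry, the
    equation A *m x = e_j would have only nonpositive summands on the left, one
    of them negative, and 0 on the right. Conversely the restriction of x to the component
    of j satisfies the same equation, hence is x. *)
Lemma sg_Mmatrix_inv (R : realType) n (A : 'M[R]_n) (x : 'cV[R]_n) (j i : 'I_n) :
  covariance_matrix A -> (forall i j, i != j -> A i j <= 0) ->
  A *m x = delta_mx j 0 ->
  Num.sg (x i 0) = (connect [rel a b | A a b != 0] j i)%:R.
Proof.
move=> Acov A_off Ax.
have Axk k : (A *m x) k 0 = (k == j)%:R by rewrite Ax mxE eqxx andbT.
have x_ge0 : forall k, 0 <= x k 0.
  by apply: (Mmatrix_ge0 Acov A_off) => k; rewrite Axk ler0n.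
have [A_sym _] := Acov.
have xj : 0 < x j 0 by exact: covariance_column_gt0 Acov Ax.
have step a b : A a b != 0 -> 0 < x a 0 -> 0 < x b 0.
  move=> Aab xa; rewrite lt0r x_ge0 andbT; apply/eqP => xb.
  have bj : b != j by apply: contraTneq xj => <-; rewrite xb ltxx.
  have ba : b != a by apply: contraTneq xa => <-; rewrite xb ltxx.
  have Aba : A b a < 0.
    by rewrite lt_neqAle A_off // andbT -[A]A_sym mxE.
  have := Axk b; rewrite (negPf bj) mxE (bigD1 a) //= => /eqP.
  suff : A b a * x a 0 + \sum_(k < n | k != a) A b k * x k 0 < 0.
    by move=> /lt_eqF ->.
  apply: ltr_wnDr; last by rewrite nmulr_rlt0.
  apply: sumr_le0 => k _; have [<-|bk] := eqVneq b k; first by rewrite xb mulr0.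
  by rewrite mulr_le0_ge0 // A_off.
have [ji|nji] := boolP (connect _ j i).
  suff xi : 0 < x i 0 by rewrite gtr0_sg.
  case/connectP: ji => s + ->; elim: s j xj {A_sym Ax Axk} => //= b s IHs a xa.
  by case/andP => Aab; apply: IHs; apply: step xa.
set S := connect _ in nji.
pose y : 'cV[R]_n := \col_k if S j k then x k 0 else 0.
suff -> : x = y by rewrite mxE (negPf nji) sgr0.
apply: (covariance_inj Acov); rewrite Ax; apply/colP => k; rewrite [LHS]mxE eqxx andbT.
have cross a b : S j a -> ~~ S j b -> A a b = 0.
  move=> ja jb; apply/eqP; apply: contraNT jb => Aab.
  exact: connect_trans ja (connect1 _).
have [jk|jk] := boolP (S j k).
  rewrite -Axk !mxE; apply: eq_bigr => l _; rewrite mxE; case: ifPn => // jl.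
  by rewrite (cross k l) // !mul0r.
have -> : (k == j) = false by apply: contraNF jk => /eqP ->; exact: connect0.
rewrite mxE big1 // => l _; rewrite mxE; case: ifPn => [jl|_]; last by rewrite mulr0.
by rewrite -[A]A_sym mxE (cross l k) // mul0r.
Qed.

(** The principal submatrix of A on the complement of K, completed by an
    identity block on K. It keeps the index type, so that no matrices indexed by
    subsets are needed; its graph is that of A with the vertices of K isolated. *)
Definition isolate (R : realType) n (K : {set 'I_n}) (A : 'M[R]_n) : 'M[R]_n :=
  \matrix_(i, j) if (i \in K) || (j \in K) then (i == j)%:R else A i j.

Lemma covariance_isolate (R : realType) n (K : {set 'I_n}) (A : 'M[R]_n) :
  covariance_matrix A -> covariance_matrix (isolate K A).
Proof.
move=> [A_sym A_pos]; split=> [|v v0].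
  by apply/matrixP => i j; rewrite !mxE orbC eq_sym -[in LHS]A_sym mxE.
pose w : 'cV[R]_n := \col_i if i \in K then 0 else v i 0.
have -> : (v^T *m isolate K A *m v) 0 0 =
    (w^T *m A *m w) 0 0 + \sum_(i in K) v i 0 ^+ 2.
  rewrite -!mulmxA !mulmx_entry [X in _ = _ + X]big_mkcond -big_split /=.
  apply: eq_bigr => i _; rewrite !mxE; case: ifPn => iK.
    rewrite mul0r add0r (bigD1 i) //= big1 => [|l li].
      by rewrite mxE iK eqxx mul1r addr0 expr2.
    by rewrite mxE iK eq_sym (negPf li) mul0r.
  rewrite addr0; congr (_ * _); apply: eq_bigr => l _; rewrite !mxE (negPf iK) /=.
  case: ifP => // lK; rewrite mulr0.
  suff -> : (i == l) = false by rewrite mul0r.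
  by apply: contraNF iK => /eqP ->.
have sq_ge0 : 0 <= \sum_(i in K) v i 0 ^+ 2.
  by apply: sumr_ge0 => i _; exact: sqr_ge0.
have [w0|/A_pos wAw] := eqVneq w 0; last exact: ltr_wpDr.
rewrite w0 mulmx0 mxE add0r lt0r sq_ge0 andbT.
apply: contraNneq v0 => /eqP; rewrite psumr_eq0 => [/allP vK|i _]; last exact: sqr_ge0.
apply/eqP/colP => i; rewrite mxE; have [iK|iK] := boolP (i \in K).
  by apply/eqP; rewrite -sqrf_eq0; apply: (implyP (vK i _)); rewrite ?mem_index_enum.
by move/colP/(_ i): w0; rewrite !mxE (negPf iK).
Qed.

(** Conditioning on K amounts to restricting the concentration matrix to the
    complement of K: up to a positive factor, a_{ij|K} is an entry of the
    inverse of that restriction. The image of x under the concentration matrix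
    is the vector y required by [sg_almost_principal_minor]. *)
Lemma ex_conditional_column (R : realType) n (Sigma : 'M[R]_n) (K : {set 'I_n})
    (j : 'I_n) : covariance_matrix Sigma -> j \notin K ->
  exists2 x : 'cV[R]_n, isolate K (invmx Sigma) *m x = delta_mx j 0 &
    [/\ forall k, k \in K -> x k 0 = 0,
        forall m, m \notin K -> (invmx Sigma *m x) m 0 = (m == j)%:R
      & forall i, Num.sg (almost_principal_minor Sigma i j K) = Num.sg (x i 0)].
Proof.
move=> Scov jK; set Q := invmx Sigma.
have Ccov : covariance_matrix (isolate K Q) by exact/covariance_isolate/covariance_inv.
pose x := invmx (isolate K Q) *m (delta_mx j 0 : 'cV[R]_n).
exists x; first by rewrite mulKVmx // covariance_unit.
have Cx k : (isolate K Q *m x) k 0 = (k == j)%:R.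
  by rewrite mulKVmx ?covariance_unit // mxE eqxx andbT.
have xK k : k \in K -> x k 0 = 0.
  move=> kK; have := Cx k; rewrite mxE (bigD1 k) //= big1 => [|l lk].
    rewrite mxE kK eqxx mul1r addr0 => ->.
    by case: eqP kK jK => // -> ->.
  by rewrite mxE kK eq_sym (negPf lk) mul0r.
have Qx m : m \notin K -> (Q *m x) m 0 = (m == j)%:R.
  move=> mK; rewrite -Cx !mxE; apply: eq_bigr => l _; rewrite [isolate _ _ _ _]mxE.
  by rewrite (negPf mK) /=; case: ifP => // /xK ->; rewrite !mulr0.
split=> // i; rewrite (@sg_almost_principal_minor _ _ Sigma i j K (Q *m x)) //.
  by rewrite mulKVmx // covariance_unit.
by move=> k; rewrite mulKVmx ?covariance_unit //; exact: xK.
Qed.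

Lemma covariance_diag_gt0 (R : realType) n (A : 'M[R]_n) i :
  covariance_matrix A -> 0 < A i i.
Proof.
move=> [_ A_pos]; have e0 : delta_mx i 0 != 0 :> 'cV[R]_n.
  by apply/eqP => /matrixP/(_ i 0)/eqP; rewrite !mxE !eqxx oner_eq0.
have := A_pos _ e0; rewrite trmx_delta -rowE -colE !mxE; exact.
Qed.

(** All the conditions on almost-principal minors reduce to those at the full
    conditioning sets, where a_{ij|K} has the sign opposite to that of the
    (i, j) entry of the inverse. *)
Lemma realizes_graphP (R : realType) n (Sigma : 'M[R]_n) (Gamma : simple_graph n) :
  covariance_matrix Sigma ->
  realizes Sigma (map_of_zero_set (graph_gaussoid Gamma)) <->
  forall i j, i != j -> Num.sg (invmx Sigma i j) = - (adjacent Gamma i j)%:R.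
Proof.
move=> Scov; have Qcov := covariance_inv Scov; set Q := invmx Sigma in Qcov *.
split=> [real i j ij|Qsg i j K ij iK jK].
  pose K := ~: [set i; j]%SET.
  have [iK jK] : i \notin K /\ j \notin K by rewrite !inE !eqxx orbT.
  have [x Cx [xK Qx sgx]] := ex_conditional_column Scov jK.
  have sgxi := sgx i; rewrite real // apval_graph // linked_full // in sgxi.
  have xj : 0 < x j 0 by apply: covariance_column_gt0 Cx; exact: covariance_isolate.
  (* Row i of Q *m x = 0 on the complement of K reads Q i i * x i + Q i j * x j = 0. *)
  have := Qx i iK; rewrite (negPf ij) mxE (bigD1 i) //= (bigD1 j) 1?eq_sym //=.
  rewrite big1 => [|k /andP[ki kj]]; last first.
    by rewrite xK ?mulr0 // !inE (negPf ki) (negPf kj).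
  rewrite addr0 => /eqP; rewrite addrC addr_eq0 => /eqP /(congr1 Num.sg).
  rewrite sgrN !sgrM -sgxi (gtr0_sg xj) mulr1 => ->.
  by rewrite (gtr0_sg (covariance_diag_gt0 i Qcov)) mul1r.
have [x Cx [_ _ ->]] := ex_conditional_column Scov jK.
rewrite (sg_Mmatrix_inv i _ _ Cx); first last.
- move=> a b ab; rewrite mxE (negPf ab); case: ifP => // _.
  by rewrite -sgr_le0 Qsg // oppr_le0 ler0n.
- exact: covariance_isolate.
rewrite apval_graph // linked_sym; congr (nat_of_bool _)%:R.
have relE a b : a != b -> (isolate K Q a b != 0) = avoiding Gamma K a b.
  move=> ab; rewrite mxE (negPf ab) /avoiding /=.
  have [//|_] := boolP (a \in K); first by rewrite eqxx andbF.
  have [//|_] := boolP (b \in K); first by rewrite eqxx andbF.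
  by rewrite andbT -sgr_eq0 Qsg // oppr_eq0 pnatr_eq0 eqb0 negbK.
apply/idP/idP; apply: connect_sub => a b /= ab.
  have [->|a_b] := eqVneq a b; first exact: connect0.
  by apply: connect1; rewrite -relE.
apply: connect1; rewrite /= relE //.
by move: ab; rewrite /avoiding /= => /andP[/adjacent_neq].
Qed.

End CovarianceMatrices.

(** * Continuity, and the ball as an orthant *)

Section Homeomorphisms.
Set Implicit Arguments.
Unset Strict Implicit.
Import Order.TTheory GRing.Theory Num.Theory.
Local Open Scope classical_set_scope.
Local Open Scope ring_scope.

Lemma homeomorphic_sym (T U : topologicalType) :
  homeomorphic T U -> homeomorphic U T.
Proof. by move=> [f [g [? ? ? ?]]]; exists g, f. Qed.

Lemma homeomorphic_trans (T U V : topologicalType) :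
  homeomorphic T U -> homeomorphic U V -> homeomorphic T V.
Proof.
move=> [f [f' [fc f'c fK f'K]]] [g [g' [gc g'c gK g'K]]].
exists (g \o f), (f' \o g'); split; [| |exact: can_comp|exact: can_comp].
  by move=> x; apply: continuous_comp; [exact: fc|exact: gc].
by move=> x; apply: continuous_comp; [exact: g'c|exact: f'c].
Qed.

(** Continuity of f at the points of A as a map on the whole space is what the
    explicit formulas below provide. *)
Lemma continuous_set_type (T U : topologicalType) (A : set T) (B : set U)
    (f : T -> U) (h : set_type A -> set_type B) :
  (forall x, A x -> {for x, continuous f}) ->
  (forall x, set_val (h x) = f (set_val x)) -> continuous h.
Proof.
move=> fc hE.
apply: (@continuous_comp_initial (set_type B) (set_type A) U set_val h).
have -> : set_val \o h = f \o set_val by apply/funext => x; exact: hE.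
move=> x; apply: continuous_comp.
  exact: (@initial_continuous (set_type A) T set_val).
by apply: fc; exact: set_valP.
Qed.

Lemma homeomorphic_sets (T U : topologicalType) (A : set T) (B : set U)
    (f : T -> U) (g : U -> T) :
  (forall x, A x -> B (f x)) -> (forall y, B y -> A (g y)) ->
  (forall x, A x -> {for x, continuous f}) ->
  (forall y, B y -> {for y, continuous g}) ->
  (forall x, A x -> g (f x) = x) -> (forall y, B y -> f (g y) = y) ->
  homeomorphic (set_type A) (set_type B).
Proof.
move=> fAB gBA fc gc fK gK.
pose h (x : set_type A) : set_type B := SigSub (mem_set (fAB _ (set_valP x))).
pose k (y : set_type B) : set_type A := SigSub (mem_set (gBA _ (set_valP y))).
exists h, k; split.
- exact: continuous_set_type fc _.
- exact: continuous_set_type gc _.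
- by move=> x; apply: val_inj; rewrite /= fK //; exact: set_valP.
- by move=> y; apply: val_inj; rewrite /= gK //; exact: set_valP.
Qed.

Lemma cvg_matrix (R : realType) m n (T : Type) (F : set_system T)
    (f : T -> 'M[R]_(m, n)) (l : 'M[R]_(m, n)) : Filter F ->
  (forall i j, f t i j @[t --> F] --> l i j) -> f @ F --> l.
Proof.
move=> FF fl S [P Pl PS].
have : \forall t \near F, forall ij : 'I_m * 'I_n, P ij.1 ij.2 (f t ij.1 ij.2).
  by apply: filter_forall => -[i j]; exact: (fl i j _ (Pl i j)).
by apply: filterS => t Pt; apply: PS => i j; exact: (Pt (i, j)).
Qed.

Lemma cvg_entry (R : realType) m n (T : Type) (F : set_system T)
    (f : T -> 'M[R]_(m, n)) (l : 'M[R]_(m, n)) i j : Filter F ->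
  f @ F --> l -> f t i j @[t --> F] --> l i j.
Proof.
move=> FF fl; apply: (@cvg_comp _ _ _ f (fun M => M i j) _ _ _ fl).
exact: (@coord_continuous R m n i j l).
Qed.

Lemma cvg_sum (R : realType) (T I : Type) (F : set_system T) (r : seq I)
    (P : pred I) (f : I -> T -> R) (l : I -> R) : Filter F ->
  (forall i, P i -> f i t @[t --> F] --> l i) ->
  \sum_(i <- r | P i) f i t @[t --> F] --> \sum_(i <- r | P i) l i.
Proof. by move=> FF fl; apply: cvg_big => //; exact: add_continuous. Qed.

Lemma cvg_prod (R : realType) (T I : Type) (F : set_system T) (r : seq I)
    (P : pred I) (f : I -> T -> R) (l : I -> R) : Filter F ->
  (forall i, P i -> f i t @[t --> F] --> l i) ->
  \prod_(i <- r | P i) f i t @[t --> F] --> \prod_(i <- r | P i) l i.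
Proof. by move=> FF fl; apply: cvg_big => //; exact: mul_continuous. Qed.

Lemma cvg_det (R : realType) n (T : Type) (F : set_system T)
    (f : T -> 'M[R]_n) (l : 'M[R]_n) : Filter F ->
  (forall i j, f t i j @[t --> F] --> l i j) ->
  \det (f t) @[t --> F] --> \det l.
Proof.
move=> FF fl; apply: cvg_sum => s _; apply: cvgM; first exact: cvg_cst.
by apply: cvg_prod => i _; exact: fl.
Qed.

(** Near an invertible matrix, inversion is given by the adjugate formula, whose
    entries are rational functions. *)
Lemma cvg_invmx (R : realType) n (T : Type) (F : set_system T)
    (f : T -> 'M[R]_n) (l : 'M[R]_n) : Filter F -> l \in unitmx ->
  f @ F --> l -> invmx (f t) @[t --> F] --> invmx l.
Proof.
move=> FF lu fl.
have fl_ij i j : f t i j @[t --> F] --> l i j by exact: cvg_entry.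
have det_l : \det l != 0 by rewrite unitmxE unitfE in lu.
have det_f : \det (f t) @[t --> F] --> \det l by exact: cvg_det.
have det_f0 : \forall t \near F, \det (f t) != 0.
  have := det_f [set x : R | x != 0]; apply.
  by apply: open_nbhs_nbhs; split=> //; exact: open_neq.
have invE : {near F, (fun t => (\det (f t))^-1 *: \adj (f t)) =1 (fun t => invmx (f t))}.
  by apply: filterS det_f0 => t ft; rewrite /invmx unitmxE unitfE ft.
apply: cvg_trans (near_eq_cvg invE) _.
rewrite /invmx lu; apply: cvg_matrix => i j.
rewrite mxE; under eq_cvg do rewrite mxE.
apply: cvgM; first exact: cvgV.
rewrite mxE; under eq_cvg do rewrite mxE.
apply: cvgM; first exact: cvg_cst.
by apply: cvg_det => a b; rewrite !mxE; under eq_cvg do rewrite !mxE; exact: fl_ij.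
Qed.

(** The radial map x / sqrt (1 - |x|^2), with inverse z / sqrt (1 + |z|^2),
    stretches the ball onto the whole space, which the coordinatewise
    exponential maps onto the orthant. *)
Lemma homeomorphic_ball_orthant (R : realType) d :
  homeomorphic (set_type (open_unit_ball R d))
               (set_type [set y : 'rV[R]_d | forall k, 0 < y 0 k]).
Proof.
pose nrm (x : 'rV[R]_d) : R := \sum_(k < d) x 0 k ^+ 2.
pose lnr (y : 'rV[R]_d) : 'rV[R]_d := \row_k ln (y 0 k).
pose f (x : 'rV[R]_d) : 'rV[R]_d := \row_k expR (x 0 k * (Num.sqrt (1 - nrm x))^-1).
pose g (y : 'rV[R]_d) : 'rV[R]_d :=
  \row_k (ln (y 0 k) * (Num.sqrt (1 + nrm (lnr y)))^-1).
have nrm_ge0 x : 0 <= nrm x by apply: sumr_ge0 => k _; exact: sqr_ge0.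
have nrmZ (x : 'rV[R]_d) (c : R) : nrm (\row_k (x 0 k * c)) = nrm x * c ^+ 2.
  by rewrite /nrm mulr_suml; apply: eq_bigr => k _; rewrite mxE exprMn.
have add_gt0 x : 0 < 1 + nrm x by rewrite ltr_wpDr.
have nrm_cvg (F : set_system 'rV[R]_d) (FF : Filter F) (h : 'rV[R]_d -> 'rV[R]_d) (l : 'rV[R]_d) :
    (forall k, h x 0 k @[x --> F] --> l 0 k) -> nrm (h x) @[x --> F] --> nrm l.
  by move=> hl; apply: cvg_sum => k _; rewrite expr2; apply: cvgM.
have gE (y : 'rV[R]_d) : g y = \row_k (lnr y 0 k * (Num.sqrt (1 + nrm (lnr y)))^-1).
  by apply/rowP => k; rewrite !mxE.
apply: (@homeomorphic_sets _ _ _ _ f g).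
- by move=> x _ k; rewrite mxE expR_gt0.
- move=> y _; rewrite gE /open_unit_ball /= -/(nrm _) nrmZ exprVn sqr_sqrtr ?ltW //.
  by rewrite ltr_pdivrMr // mul1r ltrDr.
- move=> x x1; apply: (@cvg_matrix _ _ _ _ (nbhs x)) => i k; rewrite mxE; under eq_cvg do rewrite mxE.
  apply: continuous_cvg; first exact: continuous_expR.
  apply: cvgM; first exact: cvg_entry.
  apply: cvgV; first by rewrite gt_eqF // sqrtr_gt0 subr_gt0.
  apply: continuous_cvg; first exact: sqrt_continuous.
  apply: cvgB; first exact: cvg_cst.
  by apply: nrm_cvg => l; exact: cvg_entry.
- move=> y y0; apply: (@cvg_matrix _ _ _ _ (nbhs y)) => i k; rewrite mxE; under eq_cvg do rewrite mxE.
  have ln_cvg l : ln (z 0 l) @[z --> y] --> ln (y 0 l).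
    have coord : z 0 l @[z --> y] --> y 0 l by exact: coord_continuous.
    exact: (continuous_cvg (nbhs_filter y) (continuous_ln (y0 l)) coord).
  apply: cvgM; first exact: ln_cvg.
  apply: cvgV; first by rewrite gt_eqF // sqrtr_gt0.
  apply: continuous_cvg; first exact: sqrt_continuous.
  apply: cvgD; first exact: cvg_cst.
  by apply: nrm_cvg => l; rewrite mxE; under eq_cvg do rewrite mxE; exact: ln_cvg.
- move=> x x1; have s0 : 0 < 1 - nrm x by rewrite subr_gt0.
  have lnf : lnr (f x) = \row_k (x 0 k * (Num.sqrt (1 - nrm x))^-1).
    by apply/rowP => k; rewrite !mxE expRK.
  rewrite gE lnf nrmZ exprVn sqr_sqrtr ?ltW //.
  have -> : 1 + nrm x / (1 - nrm x) = (1 - nrm x)^-1.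
    by rewrite -{1}(divff (lt0r_neq0 s0)) -mulrDl subrK mul1r.
  apply/rowP => k; rewrite !mxE sqrtrV ?ltW // invrK divfK //.
  by rewrite gt_eqF // sqrtr_gt0.
- move=> y y0.
  have s0 : 0 < Num.sqrt (1 + nrm (lnr y)) by rewrite sqrtr_gt0.
  have nrmg : 1 - nrm (g y) = (1 + nrm (lnr y))^-1.
    rewrite gE nrmZ exprVn sqr_sqrtr ?ltW //.
    by rewrite -{1}(divff (lt0r_neq0 (add_gt0 (lnr y)))) -mulrBl addrK mul1r.
  apply/rowP => k; rewrite mxE nrmg mxE sqrtrV ?ltW // invrK divfK ?gt_eqF //.
  by rewrite lnK // posrE.
Qed.

End Homeomorphisms.

(** * A chart of the realization space *)

Section Parametrization.
Set Implicit Arguments.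
Unset Strict Implicit.
Import Order.TTheory GRing.Theory Num.Theory.
Local Notation adjacent := Defs.adjacent.
Local Open Scope classical_set_scope.
Local Open Scope ring_scope.

(** Substituting v i = t i * u i, twice the quadratic form of A at v is
    2 * sum_i u i (A u) i (t i)^2 - sum_{i, j} A i j u i u j (t i - t j)^2,
    in which the first sum is positive and the second one nonpositive. *)
Lemma covariance_Mmatrix (R : realType) n (A : 'M[R]_n) (u : 'cV[R]_n) :
  A^T = A -> (forall i j, i != j -> A i j <= 0) ->
  (forall i, 0 < u i 0) -> (forall i, 0 < (A *m u) i 0) ->
  covariance_matrix A.
Proof.
move=> A_sym A_off u0 Au0; split=> // v v0.
have As i j : A i j = A j i by rewrite -[in LHS]A_sym mxE.
pose t i := v i 0 / u i 0.
have vE i : v i 0 = t i * u i 0 by rewrite divfK // gt_eqF.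
pose c i j := A i j * (u i 0 * u j 0).
have cs i j : c i j = c j i by rewrite /c As (mulrC (u i 0)).
have c_le0 i j : i != j -> c i j <= 0.
  by move=> /A_off Aij; rewrite mulr_le0_ge0 // mulr_ge0 // ltW.
have E1 : (v^T *m A *m v) 0 0 = \sum_i \sum_j c i j * (t i * t j).
  rewrite -mulmxA mulmx_entry; apply: eq_bigr => i _; rewrite mxE mulr_sumr.
  by apply: eq_bigr => j _; rewrite /c (vE i) (vE j); ring.
have E2 : \sum_i \sum_j c i j * (t i ^+ 2 + t j ^+ 2)
    = (\sum_i u i 0 * (A *m u) i 0 * t i ^+ 2) *+ 2.
  have E : \sum_i \sum_j c i j * t i ^+ 2 = \sum_i u i 0 * (A *m u) i 0 * t i ^+ 2.
    apply: eq_bigr => i _; rewrite -mulr_suml mxE; congr (_ * _).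
    by rewrite mulr_sumr; apply: eq_bigr => j _; rewrite /c mulrCA.
  rewrite mulr2n -{1}E -E [X in _ = _ + X]exchange_big -big_split /=.
  apply: eq_bigr => i _; rewrite -big_split /=; apply: eq_bigr => j _.
  by rewrite mulrDr (cs j i).
have E3 : (v^T *m A *m v) 0 0 *+ 2 =
    (\sum_i u i 0 * (A *m u) i 0 * t i ^+ 2) *+ 2
    - \sum_i \sum_j c i j * (t i - t j) ^+ 2.
  rewrite E1 -E2 -sumrB -sumrMnl; apply: eq_bigr => i _.
  rewrite -sumrB -sumrMnl; apply: eq_bigr => j _.
  by ring.
rewrite -(pmulrn_lgt0 _ (isT : (0 < 2)%N)) E3.
apply: ltr_wpDr.
  rewrite oppr_ge0; apply: sumr_le0 => i _; apply: sumr_le0 => j _.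
  have [->|ij] := eqVneq i j; first by rewrite subrr expr0n mulr0.
  by rewrite mulr_le0_ge0 ?sqr_ge0 ?c_le0.
rewrite pmulrn_lgt0 //.
have term_ge0 i : 0 <= u i 0 * (A *m u) i 0 * t i ^+ 2.
  by rewrite mulr_ge0 ?sqr_ge0 // mulr_ge0 // ltW.
rewrite lt0r sumr_ge0 // andbT; apply: contraNneq v0 => /eqP.
rewrite psumr_eq0 // => /allP t0; apply/eqP/colP => i; rewrite mxE vE.
have := implyP (t0 i (mem_index_enum _)) isT.
rewrite mulf_eq0 sqrf_eq0 mulf_eq0 (gt_eqF (u0 i)) (gt_eqF (Au0 i)) /= => /eqP ->.
exact: mul0r.
Qed.

Definition weight (R : realType) n (Gamma : simple_graph n)
    (y : 'rV[R]_(#|edges Gamma| + n)) (i j : 'I_n) : R :=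
  \sum_(k < #|edges Gamma|)
    if enum_val k == [set i; j]%SET then y 0 (lshift n k) else 0.

(** The remaining coordinates become the vector u on which the concentration
    matrix takes the value (1, ..., 1), that is, the row sums of the covariance
    matrix. *)
Definition potential (R : realType) n (Gamma : simple_graph n)
    (y : 'rV[R]_(#|edges Gamma| + n)) : 'cV[R]_n :=
  \col_i y 0 (rshift #|edges Gamma| i).

(** The diagonal entries are the only ones for which the potential is mapped to
    (1, ..., 1). *)
Definition concentration (R : realType) n (Gamma : simple_graph n)
    (y : 'rV[R]_(#|edges Gamma| + n)) : 'M[R]_n :=
  \matrix_(i, j)
    if i == j then (1 + \sum_l weight y i l * potential y l 0) / potential y i 0
    else - weight y i j.

Lemma edge_ends n (Gamma : simple_graph n) (k : 'I_#|edges Gamma|) :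
  exists p : 'I_n * 'I_n, adjacent Gamma p.1 p.2 /\ enum_val k = [set p.1; p.2]%SET.
Proof.
have kE := enum_valP k; have := forall_inP (valP Gamma) _ kE.
by move=> /cards2P[i [j [_ ij]]]; exists (i, j); rewrite /adjacent /= -ij.
Qed.

Lemma adjacent_edge n (Gamma : simple_graph n) i j : adjacent Gamma i j ->
  exists k : 'I_#|edges Gamma|, enum_val k = [set i; j]%SET.
Proof.
move=> ij; have ijE : [set i; j]%SET \in edges Gamma by [].
by exists (enum_rank_in ijE [set i; j]%SET); rewrite enum_rankK_in.
Qed.

Lemma weight_edge (R : realType) n (Gamma : simple_graph n)
    (y : 'rV[R]_(#|edges Gamma| + n)) i j k :
  enum_val k = [set i; j]%SET -> weight y i j = y 0 (lshift n k).
Proof.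
move=> kE; rewrite /weight (bigD1 k) //= kE eqxx big1 ?addr0 // => l lk.
by rewrite -kE (inj_eq enum_val_inj) (negPf lk).
Qed.

Lemma weight_nonedge (R : realType) n (Gamma : simple_graph n)
    (y : 'rV[R]_(#|edges Gamma| + n)) i j :
  ~~ adjacent Gamma i j -> weight y i j = 0.
Proof.
move=> nij; apply: big1 => k _; case: eqP => // kE.
by move: nij; rewrite /adjacent -kE enum_valP.
Qed.

Lemma weight_sym (R : realType) n (Gamma : simple_graph n)
    (y : 'rV[R]_(#|edges Gamma| + n)) i j : weight y i j = weight y j i.
Proof. by rewrite /weight finset.setUC. Qed.

Lemma weight_diag (R : realType) n (Gamma : simple_graph n)
    (y : 'rV[R]_(#|edges Gamma| + n)) i : weight y i i = 0.
Proof. by apply: weight_nonedge; apply/negP => /adjacent_neq; rewrite eqxx. Qed.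

Lemma sg_weight (R : realType) n (Gamma : simple_graph n)
    (y : 'rV[R]_(#|edges Gamma| + n)) i j : (forall k, 0 < y 0 k) ->
  Num.sg (weight y i j) = (adjacent Gamma i j)%:R.
Proof.
move=> y0; have [/adjacent_edge[k kE]|nij] := boolP (adjacent Gamma i j).
  by rewrite (weight_edge y kE) gtr0_sg.
by rewrite weight_nonedge // sgr0.
Qed.

Lemma sg_concentration (R : realType) n (Gamma : simple_graph n)
    (y : 'rV[R]_(#|edges Gamma| + n)) i j : (forall k, 0 < y 0 k) -> i != j ->
  Num.sg (concentration y i j) = - (adjacent Gamma i j)%:R.
Proof. by move=> y0 ij; rewrite mxE (negPf ij) sgrN sg_weight. Qed.

Lemma concentration_potential (R : realType) n (Gamma : simple_graph n)
    (y : 'rV[R]_(#|edges Gamma| + n)) : (forall k, 0 < y 0 k) ->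
  concentration y *m potential y = const_mx 1.
Proof.
move=> y0; apply/colP => i; rewrite [RHS]mxE mxE (bigD1 i) //= mxE eqxx divfK.
  rewrite [X in 1 + X](bigD1 i) //= weight_diag mul0r add0r -addrA -big_split /=.
  rewrite big1 ?addr0 // => l li.
  by rewrite [concentration _ _ _]mxE eq_sym (negPf li) mulNr subrr.
by rewrite mxE gt_eqF.
Qed.

Lemma covariance_concentration (R : realType) n (Gamma : simple_graph n)
    (y : 'rV[R]_(#|edges Gamma| + n)) : (forall k, 0 < y 0 k) ->
  covariance_matrix (concentration y).
Proof.
move=> y0; apply: (@covariance_Mmatrix _ _ _ (potential y)).
- apply/matrixP => i j; rewrite !mxE eq_sym weight_sym.
  by case: eqP => // ->.
- by move=> i j ij; rewrite -sgr_le0 sg_concentration // oppr_le0 ler0n.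
- by move=> i; rewrite mxE.
- by move=> i; rewrite concentration_potential // mxE.
Qed.

(** A matrix with the right zeros is determined by its values on the edges and
    by a vector without zero entries that it maps to (1, ..., 1), because the
    rows of that equation can be solved for the diagonal entries. *)
Lemma concentration_surj (R : realType) n (Gamma : simple_graph n)
    (Q : 'M[R]_n) (y : 'rV[R]_(#|edges Gamma| + n)) :
  (forall i j, i != j -> ~~ adjacent Gamma i j -> Q i j = 0) ->
  (forall i, potential y i 0 != 0) -> Q *m potential y = const_mx 1 ->
  (forall k i j, enum_val k = [set i; j]%SET -> y 0 (lshift n k) = - Q i j) ->
  concentration y = Q.
Proof.
move=> Q0 u0 Qu yQ.
have wQ i j : i != j -> weight y i j = - Q i j.
  move=> ij; have [/adjacent_edge[k kE]|nij] := boolP (adjacent Gamma i j).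
    by rewrite (weight_edge y kE) (yQ k i j).
  by rewrite weight_nonedge // Q0 // oppr0.
apply/matrixP => i j; rewrite mxE; have [<-|ij] := eqVneq i j; last first.
  by rewrite wQ // opprK.
apply: (mulIf (u0 i)); rewrite divfK //.
move/colP/(_ i): Qu; rewrite [RHS]mxE mxE (bigD1 i) //= => <-.
rewrite [X in _ + X = _](bigD1 i) //= weight_diag mul0r add0r -addrA -big_split /=.
rewrite big1 ?addr0 // => l li.
by rewrite wQ 1?eq_sym // mulNr subrr.
Qed.

(** Covariance matrices are sent to the negated edge entries of their inverses
    and to their row sums, which are positive by inverse-positivity. The inverse
    of this map sends a point of the orthant to the inverse of its
    [concentration]. *)
Lemma homeomorphic_orthant_realization (R : realType) n (Gamma : simple_graph n) :
  homeomorphic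
    (set_type [set y : 'rV[R]_(#|edges Gamma| + n) | forall k, 0 < y 0 k])
    (set_type (realization_space R (map_of_zero_set (graph_gaussoid Gamma)))).
Proof.
have [ends endsP] := choice (@edge_ends n Gamma).
pose one : 'cV[R]_n := const_mx 1.
pose f (y : 'rV[R]_(#|edges Gamma| + n)) : 'M[R]_n := invmx (concentration y).
pose g (S : 'M[R]_n) : 'rV[R]_(#|edges Gamma| + n) :=
  row_mx (\row_k - invmx S (ends k).1 (ends k).2) (\row_i \sum_l S i l).
have gl S k : g S 0 (lshift n k) = - invmx S (ends k).1 (ends k).2.
  by rewrite row_mxEl mxE.
have gr S : potential (g S) = S *m one.
  apply/colP => i; rewrite mxE row_mxEr !mxE; apply: eq_bigr => l _.
  by rewrite mxE mulr1.
have realQ S : realization_space R (map_of_zero_set (graph_gaussoid Gamma)) S ->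
    [/\ covariance_matrix S, covariance_matrix (invmx S) &
      forall i j, i != j -> Num.sg (invmx S i j) = - (adjacent Gamma i j)%:R].
  by move=> [Scov real]; split=> //; [exact: covariance_inv|exact/realizes_graphP].
have gpos S : realization_space R (map_of_zero_set (graph_gaussoid Gamma)) S ->
    forall k, 0 < g S 0 k.
  move=> /realQ[Scov Qcov Qsg] k; case: (split_ordP k) => [l ->|i ->].
    rewrite gl oppr_gt0 -sgr_lt0; have [adj _] := endsP l.
    by rewrite Qsg ?adj ?oppr_lt0 ?ltr01 // (adjacent_neq adj).
  have Qoff a b : a != b -> invmx S a b <= 0.
    by move=> ab; rewrite -sgr_le0 Qsg // oppr_le0 ler0n.
  have Qu : invmx S *m (S *m one) = one by rewrite mulKmx // covariance_unit.
  have u_ge0 : forall a, 0 <= (S *m one) a 0.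
    by apply: (Mmatrix_ge0 Qcov Qoff) => a; rewrite Qu mxE ler01.
  have -> : g S 0 (rshift #|edges Gamma| i) = (S *m one) i 0 by rewrite -gr [RHS]mxE.
  rewrite lt0r u_ge0 andbT; apply/eqP => ui.
  move/colP/(_ i)/eqP: Qu; rewrite [one i 0]mxE mxE lt_eqF //.
  apply: (le_lt_trans _ ltr01); apply: sumr_le0 => l _.
  have [->|li] := eqVneq l i; first by rewrite ui mulr0.
  by apply: mulr_le0_ge0 => //; apply: Qoff; rewrite eq_sym.
apply: (@homeomorphic_sets _ _ _ _ f g).
- move=> y y0; have Ccov := covariance_concentration y0.
  have fcov : covariance_matrix (f y) by exact: covariance_inv.
  split=> //; apply/realizes_graphP => // i j ij.
  by rewrite invmxK sg_concentration.
- exact: gpos.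
- move=> y y0.
  have u_cvg i : potential z i 0 @[z --> y] --> potential y i 0.
    rewrite mxE; under eq_cvg do rewrite mxE; exact: coord_continuous.
  have w_cvg i j : weight z i j @[z --> y] --> weight y i j.
    apply: (@cvg_sum _ _ _ (nbhs y)) => k _.
    by case: ifP => _; [exact: coord_continuous|exact: cvg_cst].
  apply: (@cvg_invmx R n _ (nbhs y) (@concentration R n Gamma)).
    exact/covariance_unit/covariance_concentration.
  apply: (@cvg_matrix _ _ _ _ (nbhs y)) => i j; rewrite mxE.
  under eq_cvg do rewrite mxE; case: eqP => _; last exact: cvgN.
  apply: cvgM; last by apply: cvgV => //; rewrite mxE gt_eqF.
  apply: cvgD; first exact: cvg_cst.
  by apply: cvg_sum => l _; apply: cvgM.
- move=> S /realQ[Scov _ _]; apply: (@cvg_matrix _ _ _ _ (nbhs S)) => i k.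
  rewrite ord1; case: (split_ordP k) => [l ->|l ->].
    rewrite gl; under eq_cvg do rewrite gl.
    apply: cvgN; apply: cvg_entry; apply: cvg_invmx => //.
    exact: covariance_unit.
  rewrite row_mxEr mxE; under eq_cvg do rewrite row_mxEr mxE.
  by apply: cvg_sum => m _; exact: coord_continuous.
- move=> y y0; have Cunit := covariance_unit (covariance_concentration y0).
  apply/rowP => k; case: (split_ordP k) => [l ->|i ->].
    have [adj kE] := endsP l.
    by rewrite gl invmxK mxE (negPf (adjacent_neq adj)) opprK (weight_edge y kE).
  have -> : g (f y) 0 (rshift #|edges Gamma| i) = potential (g (f y)) i 0.
    by rewrite [RHS]mxE.
  by rewrite gr /one -(concentration_potential y0) mulKmx // mxE.
- move=> S Sreal; have [Scov [Q_sym Q_pos] Qsg] := realQ S Sreal.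
  rewrite /f (@concentration_surj _ _ _ (invmx S)) ?invmxK //.
  + move=> i j ij nij; apply/eqP; rewrite -sgr_eq0 Qsg //.
    by rewrite (negPf nij) oppr0.
  + by move=> i; rewrite mxE gt_eqF // gpos.
  + by rewrite gr mulKmx // covariance_unit.
  move=> k i j kE; rewrite gl; congr (- _).
  have [adj] := endsP k; rewrite kE => ij.
  have iE : i \in [set (ends k).1; (ends k).2]%SET by rewrite -ij set21.
  have jE : j \in [set (ends k).1; (ends k).2]%SET by rewrite -ij set22.
  have i_j : i != j.
    by apply: (@adjacent_neq _ Gamma); rewrite /adjacent ij; exact: adj.
  case/set2P: iE i_j => ->; case/set2P: jE => ->; rewrite ?eqxx // => _.
  by rewrite -[in RHS]Q_sym mxE.
Qed.

Lemma homeomorphic_realization_ball (R : realType) n (Gamma : simple_graph n) :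
  homeomorphic
    (set_type (realization_space R (map_of_zero_set (graph_gaussoid Gamma))))
    (set_type (open_unit_ball R (#|edges Gamma| + n))).
Proof.
apply: homeomorphic_sym; apply: homeomorphic_trans (homeomorphic_ball_orthant _ _) _.
exact: homeomorphic_orthant_realization.
Qed.

Lemma graph_gaussoid_realizable (R : realType) n (Gamma : simple_graph n) :
  realization_space R (map_of_zero_set (graph_gaussoid Gamma)) !=set0.
Proof.
have [_ [g _]] := homeomorphic_realization_ball R Gamma.
(* A realization is the image of the centre of the ball. *)
have ball0 : open_unit_ball R (#|edges Gamma| + n) 0.
  by rewrite /open_unit_ball /= big1 ?ltr01 // => k _; rewrite mxE expr0n.
pose S := g (SigSub (mem_set ball0)); exists (set_val S); exact: (set_valP S).
Qed.

End Parametrization.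

Theorem theorem5p6 (R : realType) (n : nat) (hn : (0 < n)%N) :
  [/\ #|positive_gaussoids n| = (2 ^ 'C(n, 2))%N,
      [set zero_set phi | phi in positive_gaussoids n]%SET
        = [set graph_gaussoid Gamma | Gamma : simple_graph n]%SET
        /\ injective (@graph_gaussoid n),
      forall phi : {ffun apvar n -> bool}, positive_gaussoid phi ->
        exists Sigma : 'M[R]_n, covariance_matrix Sigma /\ realizes Sigma phi
    & forall Gamma : simple_graph n,
        homeomorphic
          (set_type (realization_space R (map_of_zero_set (graph_gaussoid Gamma))))
          (set_type (open_unit_ball R (#|edges Gamma| + n)))].
Proof.
split.
- exact: card_positive_gaussoids.
- by split; [exact: positive_gaussoid_zero_sets|exact: graph_gaussoid_inj].
- by move=> phi /positive_gaussoidE ->; exact: graph_gaussoid_realizable.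
exact: homeomorphic_realization_ball.
Qed.
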